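(* Let $m$ be a positive integer, $r$ a nonnegative integer, $\lambda\in\mathbb{R}$. For $n,k\in\mathbb{N}$ with $n\ge k$, $$W_{m,\lambda}^{(r)}(n+1,k)-(r-n\lambda)W_{m,\lambda}^{(r)}(n,k)=\sum_{l=k-1}^{n}\binom{n}{l}(m)_{n-l,\lambda}W_{m,\lambda}^{(r)}(l,k-1).$$
   Context: $(x)_{0,\lambda}=1$, $(x)_{n,\lambda}=x(x-\lambda)\cdots(x-(n-1)\lambda)$, $(x)_n=(x)_{n,1}$. The degenerate $r$-Whitney numbers of the second kind are defined by the polynomial identities $(mx+r)_{n,\lambda}=\sum_{k=0}^n W_{m,\lambda}^{(r)}(n,k)m^k(x)_k$, $n\ge0$, with $W_{m,\lambda}^{(r)}(n,k)=0$ for $k>n$. *)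

(* Defs.v *)
From HB Require Import structures.
From mathcomp Require Import all_boot all_order all_algebra reals ring.

Set Implicit Arguments.
Unset Strict Implicit.
Unset Printing Implicit Defensive.

Import Order.TTheory GRing.Theory Num.Theory.
Local Open Scope ring_scope.

Definition dfalling (A : pzRingType) (lambda x : A) (n : nat) : A :=
  \prod_(i < n) (x - lambda *+ i).

(* The defining relations are identities in R[X]; (X)_k is the case lambda = 1
   of dfalling. *)
Definition is_degenerate_rWhitney2 (R : realType) (m r : nat) (lambda : R)
    (W : nat -> nat -> R) : Prop :=
  (forall n : nat,
     dfalling lambda%:P (m%:R *: 'X + r%:R%:P) n
     = \sum_(0 <= k < n.+1) (W n k * m%:R ^+ k) *: dfalling 1 'X k :> {poly R})
  /\ (forall n k : nat, (n < k)%N -> W n k = 0).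

Lemma dfallingS (A : pzRingType) (lambda x : A) (n : nat) :
  dfalling lambda x n.+1 = dfalling lambda x n * (x - lambda *+ n).
Proof. by rewrite /dfalling big_ord_recr. Qed.

Lemma dfallingX_monic (R : realType) (k : nat) :
  dfalling 1 ('X : {poly R}) k \is monic.
Proof.
by apply: monic_prod => i _; rewrite -polyC1 -polyCMn monicXsubC.
Qed.

Lemma size_dfallingX (R : realType) (k : nat) :
  size (dfalling 1 ('X : {poly R}) k) = k.+1.
Proof.
elim: k => [|k IHk]; first by rewrite /dfalling big_ord0 size_poly1.
rewrite dfallingS -polyC1 -polyCMn polyC1 size_Mmonic ?monicXsubC //.
  by rewrite size_XsubC IHk addn2.
by apply: monic_neq0; apply: dfallingX_monic.
Qed.

Lemma dfallingX_free (R : realType) (n : nat) (c : nat -> R) :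
  \sum_(0 <= k < n) c k *: dfalling 1 ('X : {poly R}) k = 0 ->
  forall k, (k < n)%N -> c k = 0.
Proof.
elim: n => // n IHn; rewrite big_nat_recr //= => sum0.
have cn0 : c n = 0.
  have /(congr1 (fun p : {poly R} => p`_n)) := sum0.
  rewrite coefD coef0 coefZ coef_sum.
  rewrite big_nat big1 ?add0r => [|k /= ltkn]; last first.
    by rewrite coefZ nth_default ?mulr0 // size_dfallingX.
  have /monicP := dfallingX_monic R n.
  by rewrite /lead_coef size_dfallingX /= => ->; rewrite mulr1.
move: sum0; rewrite cn0 scale0r addr0 => /IHn IH k.
by rewrite ltnS leq_eqVlt => /predU1P[-> //|/IH].
Qed.

Lemma degenerate_rWhitney2_unique (R : realType) (m r : nat) (lambda : R)
    (W W' : nat -> nat -> R) : (0 < m)%N ->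
  is_degenerate_rWhitney2 m r lambda W ->
  is_degenerate_rWhitney2 m r lambda W' -> forall n k, W n k = W' n k.
Proof.
move=> m_gt0 [WE W0] [WE' W0'] n k.
have [ltnk|] := ltnP n k; first by rewrite W0 ?W0'.
rewrite -ltnS => ltkn.
have mk0 : m%:R ^+ k != 0 :> R by rewrite expf_neq0 // pnatr_eq0 -lt0n.
apply: (mulIf mk0); apply/eqP; rewrite -subr_eq0; apply/eqP.
pose c j := W n j * m%:R ^+ j - W' n j * m%:R ^+ j.
apply: (@dfallingX_free R n.+1 c) ltkn.
under eq_bigr do rewrite /c scalerBl.
by rewrite sumrB -WE -WE' subrr.
Qed.

Lemma degenerate_rWhitney2_exists (R : realType) (m r : nat) (lambda : R) :
  exists W : nat -> nat -> R, is_degenerate_rWhitney2 m r lambda W.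
Proof.
pose fix W (n k : nat) {struct n} : R :=
  if n is n'.+1 then
    (r%:R - lambda *+ n' + (m * k)%:R) * W n' k
    + (if k is k'.+1 then W n' k' else 0)
  else (k == 0%N)%:R.
have W0 n k : (n < k)%N -> W n k = 0.
  elim: n k => [|n IHn] [|k] //= ltnk.
  by rewrite !IHn ?mulr0 ?addr0 //; apply: ltnW.
have WS n k : W n.+1 k = (r%:R - lambda *+ n + (m * k)%:R) * W n k
    + (if k is k'.+1 then W n k' else 0) by [].
have W00 : W 0%N 0%N = 1 by [].
clearbody W; exists W; split=> // n; elim: n => [|n IHn].
  by rewrite big_nat1 /dfalling !big_ord0 W00 expr0 mulr1 scale1r.
rewrite dfallingS IHn mulr_suml.
pose f (k : nat) : {poly R} := dfalling 1 'X k.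
have step k : f k * (m%:R *: 'X + r%:R%:P - lambda%:P *+ n)
    = m%:R *: f k.+1 + (r%:R - lambda *+ n + (m * k)%:R) *: f k.
  rewrite /f dfallingS natrM -!mul_polyC !polyCD !polyCN polyCM polyCMn polyC_natr.
  by ring.
under eq_bigr do rewrite -scalerAl step scalerDr !scalerA.
rewrite big_split /= [RHS](eq_bigr (fun k =>
  ((if k is k'.+1 then W n k' else 0) * m%:R ^+ k) *: f k
  + (W n k * m%:R ^+ k * (r%:R - lambda *+ n + (m * k)%:R)) *: f k)); last first.
  move=> k _; rewrite -scalerDl; congr (_ *: _).
  rewrite WS; move: (if k is _.+1 then _ else _) => w.
  by rewrite natrM; ring.
rewrite big_split /= [X in _ = X + _]big_nat_recl //= mul0r scale0r add0r; congr (_ + _).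
  by apply: eq_bigr => k _; rewrite exprSr mulrA.
by rewrite [RHS]big_nat_recr //= W0 // !mul0r scale0r addr0.
Qed.

(* Main.v *)
Require Import Defs.
From HB Require Import structures.
From mathcomp Require Import all_boot all_order all_algebra reals.
From mathcomp Require Import ring.

Import Order.TTheory GRing.Theory Num.Theory.
Local Open Scope ring_scope.

(** With P_n(X) = (mX + r)_{n,lambda}, one has
    P_{n+1} - (r - n lambda) P_n = m X P_n, and the degenerate Vandermonde
    identity applied to mX + r = m + (m (X - 1) + r) gives
    P_n(X) = \sum_l 'C(n, l) (m)_{n-l,lambda} P_l(X - 1).  Since
    X (X - 1)_j = (X)_{j+1}, comparing the coefficients of (X)_k in m X P_n
    yields the result. *)

(** Serves two morphisms: composition with ['X - 1] and the constant embedding [polyC]. *)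
Lemma rmorph_dfalling (A B : pzRingType) (f : {rmorphism A -> B})
    (lambda x : A) (n : nat) :
  f (dfalling lambda x n) = dfalling (f lambda) (f x) n.
Proof.
rewrite /dfalling rmorph_prod; apply: eq_bigr => i _.
by rewrite rmorphB rmorphMn.
Qed.

(** Induction on [n]: the new factor splits as x + y - n lambda = (x - (n - l) lambda) + (y - l
    lambda), and each half extends one of the two falling factorials of the l-th term. *)
Lemma dfallingD (A : comPzRingType) (lambda x y : A) (n : nat) :
  dfalling lambda (x + y) n
  = \sum_(0 <= l < n.+1)
      'C(n, l)%:R * dfalling lambda x (n - l) * dfalling lambda y l.
Proof.
elim: n => [|n IHn].
  by rewrite big_nat1 /dfalling !big_ord0 bin0 !mulr1.
rewrite dfallingS IHn mulr_suml.
rewrite [LHS](eq_big_nat _ _ (F2 := fun l =>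
    'C(n, l)%:R * dfalling lambda x (n.+1 - l) * dfalling lambda y l
    + 'C(n, l)%:R * dfalling lambda x (n - l) * dfalling lambda y l.+1));
  last first.
  move=> l /= ltln; rewrite subSn // !dfallingS.
  have -> : lambda *+ n = lambda *+ (n - l) + lambda *+ l.
    by rewrite -mulrnDr subnK.
  by ring.
rewrite big_split /= [in LHS]big_nat_recl // [RHS]big_nat_recl //= !bin0 !subn0.
rewrite -addrA; congr (_ + _).
(* Pascal's rule. In the part with C(n, l + 1) the top term l = n vanishes, which makes the ranges
   agree. *)
rewrite [RHS](eq_bigr (fun l =>
    'C(n, l.+1)%:R * dfalling lambda x (n - l) * dfalling lambda y l.+1
    + 'C(n, l)%:R * dfalling lambda x (n - l) * dfalling lambda y l.+1)).
  rewrite big_split /=; congr (_ + _).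
  by rewrite [RHS]big_nat_recr //= bin_small // !mul0r addr0.
by move=> l _; rewrite binS natrD subSS; ring.
Qed.

Lemma dfalling1S_left (A : comPzRingType) (x : A) (n : nat) :
  dfalling 1 x n.+1 = x * dfalling 1 (x - 1) n.
Proof.
rewrite /dfalling big_ord_recl /= mulr0n subr0; congr (_ * _).
by apply: eq_bigr => i _; rewrite /bump /= add1n mulrS opprD addrA.
Qed.

Lemma dfallingX_inj (R : realType) (n : nat) (a b : nat -> R) :
  \sum_(0 <= k < n) a k *: dfalling 1 ('X : {poly R}) k
  = \sum_(0 <= k < n) b k *: dfalling 1 'X k ->
  forall k, (k < n)%N -> a k = b k.
Proof.
move=> eqab k ltkn; apply/eqP; rewrite -subr_eq0; apply/eqP.
apply: (@dfallingX_free R n (fun j => a j - b j)) ltkn.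
under eq_bigr do rewrite scalerBl.
by rewrite sumrB eqab subrr.
Qed.

Definition dfalling_affine {R : realType} (m r : nat) (lambda : R) (n : nat)
    : {poly R} := dfalling lambda%:P (m%:R *: 'X + r%:R%:P) n.

(** Padding with the zero coefficients W(n, k), k > n, lets expansions of different degrees share
    one summation range. *)
Lemma rWhitney2_expand_wide (R : realType) (m r : nat) (lambda : R)
    (W : nat -> nat -> R) (hW : is_degenerate_rWhitney2 m r lambda W)
    (n N : nat) : (n < N)%N ->
  dfalling_affine m r lambda n
  = \sum_(0 <= k < N) (W n k * m%:R ^+ k) *: dfalling 1 'X k.
Proof.
case: hW => WE W0 ltnN; rewrite /dfalling_affine WE.
rewrite [RHS](big_cat_nat (n := n.+1)) //= -[LHS]addr0; congr (_ + _).
rewrite big_nat big1 // => k /andP[ltnk _].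
by rewrite W0 // mul0r scale0r.
Qed.

Lemma mulX_rWhitney2_shift (R : realType) (m r : nat) (lambda : R)
    (W : nat -> nat -> R) (hW : is_degenerate_rWhitney2 m r lambda W)
    (l N : nat) : (l < N)%N ->
  'X * (dfalling_affine m r lambda l \Po ('X - 1))
  = \sum_(0 <= j < N) (W l j * m%:R ^+ j) *: dfalling 1 'X j.+1.
Proof.
move=> ltlN; rewrite (rWhitney2_expand_wide _ _ _ _ _ hW _ _ ltlN).
rewrite rmorph_sum mulr_sumr.
apply: eq_bigr => j _.
rewrite /= comp_polyZ rmorph_dfalling /= rmorph1 comp_polyX.
by rewrite dfalling1S_left -scalerAr.
Qed.

Lemma dfalling_affine_vandermonde (R : realType) (m r : nat) (lambda : R)
    (n : nat) :
  dfalling_affine m r lambda n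
  = \sum_(0 <= l < n.+1)
    ('C(n, l)%:R * dfalling lambda m%:R (n - l))
    *: (dfalling_affine m r lambda l \Po ('X - 1)).
Proof.
have -> : dfalling_affine m r lambda n = dfalling lambda%:P
    (m%:R%:P + (m%:R *: ('X - 1) + r%:R%:P)) n.
  by congr dfalling; rewrite -!mul_polyC; ring.
rewrite dfallingD; apply: eq_bigr => l _.
(* Substituting X - 1 for X is a ring morphism that fixes constants, so it acts inside the falling
   factorial. *)
rewrite /dfalling_affine (rmorph_dfalling _ _ (comp_poly ('X - 1))) /=.
rewrite comp_polyD comp_polyZ comp_polyX !comp_polyC.
by rewrite -[RHS]mul_polyC polyCM (rmorph_dfalling _ _ polyC) /= !polyC_natr.
Qed.

(** The last factor of P_{n+1} is m X + (r - n lambda). *)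
Lemma dfalling_affineS (R : realType) (m r : nat) (lambda : R)
    (n : nat) :
  dfalling_affine m r lambda n.+1
  - (r%:R - n%:R * lambda) *: dfalling_affine m r lambda n
  = m%:R *: ('X * dfalling_affine m r lambda n).
Proof.
rewrite /dfalling_affine dfallingS -!mul_polyC polyCB polyCM polyC_natr.
by rewrite -mulr_natl; ring.
Qed.

Theorem theorem16 (R : realType) (m r : nat) (lambda : R)
    (W : nat -> nat -> R) (hm : (0 < m)%N)
    (hW : is_degenerate_rWhitney2 m r lambda W)
    (n k : nat) (hk : (1 <= k)%N) (hkn : (k <= n)%N) :
  W n.+1 k - (r%:R - n%:R * lambda) * W n k
  = \sum_(k.-1 <= l < n.+1)
      'C(n, l)%:R * dfalling lambda m%:R (n - l) * W l k.-1.
Proof.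
have [_ W0] := hW.
case: k hk hkn => // k _ lekn; rewrite [k.+1.-1]/=.
pose c l := 'C(n, l)%:R * dfalling lambda m%:R (n - l).
(* Coefficients in the basis (X)_j carry a factor m^j, which is nonzero since m > 0. *)
have mk0 : m%:R ^+ k.+1 != 0 :> R by rewrite expf_neq0 // pnatr_eq0 -lt0n.
apply: (mulIf mk0).
(* [a] and [b] are the coefficients of m X P_n in the basis (X)_j, read off from the recurrence and
   from the Vandermonde expansion. The latter involves only the (X)_{j+1}, hence [b 0 = 0]. *)
pose a j := (W n.+1 j - (r%:R - n%:R * lambda) * W n j) * m%:R ^+ j.
pose b j := if j is i.+1 then (\sum_(0 <= l < n.+1) c l * W l i) * m%:R ^+ j
            else 0.
have /(_ k.+1) : forall j, (j < n.+2)%N -> a j = b j.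
  apply: dfallingX_inj.
  transitivity (m%:R *: ('X * dfalling_affine m r lambda n)).
    rewrite -dfalling_affineS !(rWhitney2_expand_wide _ _ _ _ _ hW _ n.+2) //.
    rewrite scaler_sumr -sumrB; apply: eq_bigr => j _.
    by rewrite scalerA -scalerBl /a mulrBl mulrA.
  rewrite dfalling_affine_vandermonde [RHS]big_nat_recl //= scale0r add0r.
  rewrite mulr_sumr scaler_sumr.
  (* Every inner expansion is taken over j <= n, independently of l, so that the two sums can be
     exchanged. *)
  under [LHS]eq_big_nat => l /= ltln.
    rewrite -scalerAr (mulX_rWhitney2_shift _ _ _ _ _ hW _ _ ltln) !scaler_sumr.
    over.
  rewrite exchange_big /=; apply: eq_bigr => j _.
  rewrite mulr_suml scaler_suml; apply: eq_bigr => l _.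
  by rewrite !scalerA; congr (_ *: _); rewrite exprS /c; ring.
rewrite /a /b => /(_ (leqW lekn)) ->; congr (_ * _).
(* Here [k] is the lower index k - 1 of the statement; the terms with l < [k] vanish because W(l,
   [k]) = 0. *)
rewrite (big_cat_nat (n := k)) //=; last by rewrite ltnW // ltnW.
rewrite big_nat big1 ?add0r // => l /= ltlk.
by rewrite W0 ?mulr0.
Qed.
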